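(* For positive integers $m,d,r$ and an integer $k$ with $0\le k\le m-1$, $m-k\le r\le \binom{m+d}{d}$, and a prime power $q\ge d+1$, we have $$e_r^{\mathbb A}(d,m,k;q)\ \ge\ f_r^{\mathbb A}(d,m,k;q)\qquad\text{and}\qquad e_r^{\mathbb P}(d,m,k;q)\ \ge\ f_r^{\mathbb P}(d,m,k;q).$$
   Context: $\mathbb F_q$ is the finite field with $q$ elements and $\mathbb N$ the set of non-negative integers. $S_d(m,\mathbb F_q)$ is the space of homogeneous polynomials of degree $d$ (together with $0$) in $\mathbb F_q[X_0,\dots,X_m]$; $A_{\le d}(m,\mathbb F_q)$ is the space of polynomials of degree $\le d$ in $\mathbb F_q[x_1,\dots,x_m]$. For $W\subseteq S_d(m,\mathbb F_q)$, $V(W)\subseteq\mathbb P^m$ is its common vanishing set; for $W\subseteq A_{\le d}(m,\mathbb F_q)$, $Z(W)\subseteq\mathbb A^m$ is its common zero set. Dimensions of $V(W)$ and $Z(W)$ are dimensions as algebraic sets (over $\overline{\mathbb F}_q$), and $(\mathbb F_q)$ denotes $\mathbb F_q$-rational points. The empty set satisfies every condition ''dimension $\le k$''. For $0\le k\le m-1$ and $m-k\le r\le\binom{m+d}{d}$ (with $W$ ranging over $\mathbb F_q$-linear subspaces), $$e_r^{\mathbb A}(d,m,k;q)=\max\{|Z(W)(\mathbb F_q)|: W\subseteq A_{\le d}(m,\mathbb F_q),\ \dim_{\mathbb F_q} W=r,\ \dim Z(W)\le k\},$$ $$e_r^{\mathbb P}(d,m,k;q)=\max\{|V(W)(\mathbb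 F_q)|: W\subseteq S_d(m,\mathbb F_q),\ \dim_{\mathbb F_q} W=r,\ \dim V(W)\le k\}.$$ Let $\mathcal B(d,m,k;q)$ be the set of $(\alpha_1,\dots,\alpha_m)\in\mathbb N^m$ with $0\le\alpha_i\le d-1$ for $1\le i\le m-k$ and $0\le \alpha_j\le q-1$ for $m-k+1\le j\le m$. Let $\Omega'(d,m,k;q)$ be the set of $w=(\alpha_1,\dots,\alpha_m)\in\mathcal B(d,m,k;q)$ with $\sum_j\alpha_j\le d$; it has $\binom{m+d}{d}-(m-k)$ elements. Order tuples lexicographically ($w<_{\mathrm{lex}}w'$ if $w_p<w'_p$ at the first index $p$ where they differ). For $1\le s\le |\Omega'(d,m,k;q)|$, $w'_s(d,m,k;q)$ is the $s$-th largest element of $\Omega'(d,m,k;q)$; by convention $w'_0(d,m,k;q)=(d,0,\dots,0)$. Write $w'_{r-(m-k)}(d,m,k;q)=(\alpha_1,\dots,\alpha_m)$. If $r>m-k$ define $$f_r^{\mathbb A}(d,m,k;q)=\sum_{j=1}^{m-k-1}\alpha_j d^{m-k-j}q^k+\sum_{j=m-k}^m\alpha_j q^{m-j},$$ and $f^{\mathbb A}_{m-k}(d,m,k;q)=d^{m-k}q^k$. Let $\pi_j(q)=|\mathbb P^j(\mathbb F_q)|=\frac{q^{j+1}-1}{q-1}$ for $j\ge0$ and $\pi_j(q)=0$ for $j<0$. Let $l$ be the smallest index with $\alpha_l\ne0$ (if $r=\binom{m+d}{d}$, so that $(\alpha_1,\dots,\alpha_m)=(0,\dots,0)$, put $l=m+1$),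 let $s=\min(m-l-1,k-1)$, and define $f_r^{\mathbb P}(d,m,k;q)=f_r^{\mathbb A}(d,m,k;q)+\pi_s(q)$. *)

(* Defs.v *)
From HB Require Import structures.
From mathcomp Require Import all_boot all_order all_algebra all_field.
From mathcomp Require Import mpoly.
From mathcomp Require Import boolp classical_sets.

Set Implicit Arguments.
Unset Strict Implicit.
Unset Printing Implicit Defensive.

Import Order.TTheory GRing.Theory Num.Theory.
Local Open Scope classical_set_scope.
Local Open Scope ring_scope.

(* The space A_{<= d}(m, R): msize p is the degree plus one, and msize 0 = 0. *)
Section BoundedDegree.
Variables (m : nat) (R : fieldType) (d : nat).

Definition degle_pred : {pred {mpoly R[m]}} :=
  [pred p : {mpoly R[m]} | (msize p <= d.+1)%N].

Lemma degle_submod_closed : submod_closed degle_pred.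
Proof.
split=> [|c p q]; rewrite !inE ?msize0 // => hp hq.
apply: leq_trans (msizeD_le _ _) _; rewrite geq_max hq andbT.
exact: leq_trans (msizeZ_le _ _) hp.
Qed.

HB.instance Definition _ :=
  GRing.isSubmodClosed.Build R {mpoly R[m]} degle_pred
    (GRing.submod_closed_semi degle_submod_closed).

Record degle :=
  DegLe { mpoly_of_degle :> {mpoly R[m]}; _ : mpoly_of_degle \in degle_pred }.

HB.instance Definition _ := [isSub for mpoly_of_degle].
HB.instance Definition _ := [Choice of degle by <:].
HB.instance Definition _ := [SubChoice_isSubLmodule of degle by <:].

Let N := #|{: 'X_{1..m < d.+1}}|.

Lemma degle_vecaxiom : vector_axiom N degle.
Proof.
pose f (p : degle) : 'rV[R]_N := \row_i (val p)@_(enum_val i : 'X_{1..m < d.+1}).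
pose g (r : 'rV[R]_N) : {mpoly R[m]} :=
  \sum_(i < N) r 0 i *: 'X_[(enum_val i : 'X_{1..m < d.+1})].
have gP r : g r \in degle_pred.
  rewrite rpred_sum // => i _; apply: rpredZ.
  by rewrite !inE msizeX ltnS -ltnS bmdeg.
have gE r (b : 'X_{1..m < d.+1}) : (g r)@_b = r 0 (enum_rank b).
  rewrite /g raddf_sum /= (bigD1 (enum_rank b)) //= mcoeffZ mcoeffX.
  rewrite enum_rankK eqxx mulr1 big1 ?addr0 // => j ne; rewrite mcoeffZ mcoeffX.
  rewrite (inj_eq val_inj) -(inj_eq enum_rank_inj) enum_valK (negbTE ne).
  by rewrite mulr0.
exists f => [c p q|]; first by apply/rowP=> i; rewrite !mxE /= mcoeffD mcoeffZ.
exists (fun r => DegLe (gP r)) => [p|r]; last first.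
  by apply/rowP=> i; rewrite !mxE /= gE enum_valK.
apply/val_inj/mpolyP=> b /=; case: (ltnP (mdeg b) d.+1) => hb.
  by rewrite (gE _ (BMultinom hb)) mxE enum_rankK.
have mu0 (q : {mpoly R[m]}) : q \in degle_pred -> q@_b = 0.
  rewrite inE => hq; apply/memN_msupp_eq0/msize_mdeg_ge.
  exact: leq_trans hq hb.
by rewrite !mu0 // (valP p).
Qed.

HB.instance Definition _ := Lmodule_hasFinDim.Build R degle degle_vecaxiom.

End BoundedDegree.

(* Dimension of a subset X of a space whose closed sets are given by [closed]: *)
(* all chains Y_0 < ... < Y_n of irreducible closed subsets of X have n <= k.  *)
(* It is only applied to closed X; the empty set satisfies it for every k.     *)
Section KrullDimension.
Variables (T : Type) (closed : set T -> Prop).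

Definition irreducible_set (Y : set T) : Prop :=
  Y !=set0 /\
  forall A B : set T, closed A -> closed B ->
    Y `<=` A `|` B -> Y `<=` A \/ Y `<=` B.

Definition dim_le (X : set T) (k : nat) : Prop :=
  forall (n : nat) (Y : nat -> set T),
    (forall i, (i <= n)%N -> [/\ closed (Y i), irreducible_set (Y i) & Y i `<=` X]) ->
    (forall i, (i < n)%N -> Y i `<` Y i.+1) ->
    (n <= k)%N.

End KrullDimension.

Definition zariski_closed_affine (m : nat) (K : fieldType) (Y : set 'rV[K]_m) :=
  exists S : set {mpoly K[m]},
    Y = [set x | forall p, S p -> p.@[fun i => x 0 i] = 0].

(* A point of P^m(K) is a line of K^(m+1), encoded by the canonical square    *)
(* matrix <<A>>%MS having that line as row space.                             *)
Definition projpt (m : nat) (K : fieldType) : Type :=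
  {L : 'M[K]_m.+1 | (<<L>>%MS == L) && (\rank L == 1%N)}.

Definition proj_root (m : nat) (K : fieldType) (p : {mpoly K[m.+1]})
    (L : projpt m K) : Prop :=
  forall v : 'rV[K]_m.+1, (v <= val L)%MS -> p.@[fun i => v 0 i] = 0.

Definition zariski_closed_proj (m : nat) (K : fieldType) (Y : set (projpt m K)) :=
  exists S : set {mpoly K[m.+1]},
    (forall p, S p -> exists e : nat, p \is e.-homog) /\
    Y = [set L | forall p, S p -> proj_root p L].

Definition Fbar (F : finFieldType) : closedFieldType :=
  projT1 (countable_algebraic_closure F).

Definition to_Fbar (F : finFieldType) : {rmorphism F -> Fbar F} :=
  sval (projT2 (countable_algebraic_closure F)).

(* The points of Z(W) and V(W) with coordinates in an extension iota : F -> K. *)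
Definition Zset (m d : nat) (F K : fieldType) (iota : {rmorphism F -> K})
    (W : {vspace degle m F d}) : set 'rV[K]_m :=
  [set x | forall p, p \in W -> (map_mpoly iota (val p)).@[fun i => x 0 i] = 0].

Definition Vset (m d : nat) (F K : fieldType) (iota : {rmorphism F -> K})
    (W : {vspace dhomog m.+1 F d}) : set (projpt m K) :=
  [set L | forall p, p \in W -> proj_root (map_mpoly iota (val p)) L].

Definition Z_card (m d : nat) (F : finFieldType) (W : {vspace degle m F d}) : nat :=
  #|[set x : 'rV[F]_m | `[< Zset idfun W x >]]%SET|.

Definition V_card (m d : nat) (F : finFieldType)
    (W : {vspace dhomog m.+1 F d}) : nat :=
  #|[set L : projpt m F | `[< Vset idfun W L >]]%SET|.

(* The maxima run over the finitely many possible numbers n of rational       *)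
(* points; over an empty family they would be 0.                              *)
Definition e_A (F : finFieldType) (d m k r : nat) : nat :=
  (\max_(n < #|{: 'rV[F]_m}|.+1 |
      `[< exists W : {vspace degle m F d},
            [/\ \dim W = r,
                dim_le (@zariski_closed_affine m (Fbar F)) (Zset (to_Fbar F) W) k
              & Z_card W = n] >]) n)%N.

Definition e_P (F : finFieldType) (d m k r : nat) : nat :=
  (\max_(n < #|{: projpt m F}|.+1 |
      `[< exists W : {vspace dhomog m.+1 F d},
            [/\ \dim W = r,
                dim_le (@zariski_closed_proj m (Fbar F)) (Vset (to_Fbar F) W) k
              & V_card W = n] >]) n)%N.

(* Exponent vectors (alpha_1, ..., alpha_m) are tuples indexed from 0, so     *)
(* alpha_j is the entry of index j - 1. In Omega' the sum is at most d, hence *)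
(* no element is lost by taking entries in 'I_d.+1. The type m.-tuplelexi     *)
(* carries the lexicographic order.                                           *)
Section Footprint.
Local Open Scope nat_scope.
Variables (d m k q : nat).

Definition Omega' : {set m.-tuplelexi 'I_d.+1} :=
  [set w : m.-tuplelexi 'I_d.+1 |
     [forall i : 'I_m, tnth w i < (if i.+1 <= m - k then d else q)]
     && (\sum_(i < m) tnth w i <= d)]%SET.

Definition w'0 : m.-tuplelexi 'I_d.+1 :=
  [tuple (if i == 0 :> nat then ord_max else ord0) | i < m].

(* w' s is the s-th largest element of Omega' for 1 <= s <= #|Omega'|. *)
Definition w' (s : nat) : m.-tuplelexi 'I_d.+1 :=
  nth w'0 (w'0 :: sort >=%O (enum Omega')) s.

Definition f_A (r : nat) : nat :=
  if r == m - k then d ^ (m - k) * q ^ k else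
  let alpha := w' (r - (m - k)) in
    \sum_(i < m | i.+1 <= m - k - 1) tnth alpha i * d ^ (m - k - i.+1) * q ^ k
  + \sum_(i < m | m - k <= i.+1) tnth alpha i * q ^ (m - i.+1).

Definition proj_card (j : int) : nat :=
  if j is Posz n then (q ^ n.+1 - 1) %/ (q - 1) else 0.

(* [find] returns m when all entries vanish, in which case l = m + 1. *)
Definition lead_index (r : nat) : nat :=
  (find (fun a : 'I_d.+1 => a != 0 :> nat) (w' (r - (m - k)))).+1.

Definition f_P (r : nat) : nat :=
  let l := lead_index r in
  let s : int := Order.min (m%:Z - l%:Z - 1)%R (k%:Z - 1)%R in
  f_A r + proj_card s.

End Footprint.

(* Main.v *)
(* Put n = m - k and let a_0, a_1, ... enumerate F_q. The polynomials           *)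
(*   g_w = prod_i prod_(j < w_i) (x_i - a_j), |w| <= d,                         *)
(* form a basis of A_{<=d}, because g_w does not vanish at a_w := (a_(w_i))_i,  *)
(* while it vanishes at a_v for every v != w with |v| <= |w|. Take W spanned by *)
(* the g_w for w = d e_i, i <= n, and for w among the r - n largest elements of *)
(* Omega'. The first n of these confine Z(W) to finitely many k-dimensional     *)
(* affine subspaces. As g_w(a_b) = 0 unless b >= w componentwise, which forces  *)
(* b >= w lexicographically, W vanishes at a_b for all b in the box B below     *)
(* w'_(r-n), and these are counted by the mixed-radix expansion f^A_r. In the   *)
(* projective case one homogenizes; the homogenized W also vanishes at those    *)
(* points at infinity whose first max(l, n) affine coordinates are zero.        *)
(*                                                                              *)
(* The dimension bound comes from a count: separating the consecutive terms of  *)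
(* a chain Y_0 < ... < Y_c of irreducible closed subsets of K^k by polynomials  *)
(* f_1, ..., f_c gives algebraically independent elements, so the N^c monomials *)
(* in them with exponents < N fit in a space of dimension O(N^k), and c <= k.   *)
Require Import Defs.
From mathcomp Require Import all_boot all_algebra.
From mathcomp Require Import all_order zify mpoly boolp classical_sets.

Set Implicit Arguments.
Unset Strict Implicit.
Unset Printing Implicit Defensive.

Import Order.TTheory GRing.Theory.
Local Open Scope classical_set_scope.
Local Open Scope ring_scope.

(** The exponents of W serve three ends. Evaluation at the grid points a_v is triangular in the
    weight, so the r generators are independent ([triangular_free]). The vectors d e_i bound the
    dimension ([affine_dim_le], [proj_dim_le], both through [chain_le_parameters]). The other
    exponents are lexicographically large, so the grid points of the box below alpha are common
    zeros ([f_A_le_footprint]). On X_0 = 0 a homogenized generator becomes 0 or the monomial of its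
    exponent, which involves one of the first max(l, n) variables ([exponents_lead]); the points
    where these variables vanish supply the term pi_s ([card_infinite_points], [f_PE]). *)

(** * Chains of irreducible sets *)

Section Independence.
Variables (K : fieldType) (M : nat).
Implicit Types (p g : {mpoly K[M]}) (Y : set 'rV[K]_M).

Definition vanishing Y p := forall x, Y x -> p.@[fun i => x 0 i] = 0.

(* Monomials in the f i with exponents < N, indexed by t < N ^ n through the  *)
(* digits of t in base N.                                                     *)
Fixpoint digit_prod (f : nat -> {mpoly K[M]}) (N n t : nat) : {mpoly K[M]} :=
  if n is n'.+1 then digit_prod f N n' (t %% N ^ n') * f n' ^+ (t %/ N ^ n')
  else 1.

(** Splitting off the leading digit j of t exhibits the combination as a polynomial in [f n] whose
    coefficients involve only the earlier [f i]. *)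
Lemma digit_sum_recr f N n (c : nat -> K) : (0 < N)%N ->
  \sum_(0 <= t < N ^ n.+1) c t *: digit_prod f N n.+1 t =
  \sum_(0 <= j < N) f n ^+ j *
    \sum_(0 <= t < N ^ n) c (j * N ^ n + t)%N *: digit_prod f N n t.
Proof.
move=> N0; have N0n : (0 < N ^ n)%N by rewrite expn_gt0 N0.
rewrite expnS big_nat_mul; apply: eq_bigr => j _.
rewrite mulSn addnC -{1}[(j * _)%N]add0n big_addn addKn mulr_sumr.
rewrite big_nat [RHS]big_nat; apply: eq_bigr => t /andP[_ lt].
rewrite /= [(t + _)%N]addnC modnMDl divnMDl // modn_small // divn_small // addn0.
by rewrite -scalerAr mulrC.
Qed.

(* Modulo the prime ideal of Y n.+1, the polynomial f n is a nonzerodivisor    *)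
(* that vanishes on Y n, so coefficients can be peeled off one power of f n at *)
(* a time.                                                                     *)
Lemma digit_prod_free n (Y : nat -> set 'rV[K]_M) f N : (0 < N)%N ->
    Y 0 !=set0 ->
    (forall i, (i < n)%N -> Y i `<=` Y i.+1) ->
    (forall i, (i <= n)%N -> forall p g, vanishing (Y i) (p * g) ->
       vanishing (Y i) p \/ vanishing (Y i) g) ->
    (forall i, (i < n)%N -> vanishing (Y i) (f i) /\ ~ vanishing (Y i.+1) (f i)) ->
  forall c : nat -> K,
    vanishing (Y n) (\sum_(0 <= t < N ^ n) c t *: digit_prod f N n t) ->
    forall t, (t < N ^ n)%N -> c t = 0.
Proof.
move=> N0 [x0 Yx0]; elim: n => [|n IH] sub prY fY c.
  rewrite expn0 big_nat1 /= => /(_ _ Yx0); rewrite mevalZ meval1 mulr1 => c0.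
  by case.
have N0n : (0 < N ^ n)%N by rewrite expn_gt0 N0.
have {}IH := IH (fun i li => sub i (ltnW li)) (fun i li => prY i (leqW li))
  (fun i li => fY i (ltnW li)).
rewrite digit_sum_recr //.
have peel L (b : nat -> nat -> K) :
    vanishing (Y n.+1) (\sum_(0 <= j < L) f n ^+ j *
      \sum_(0 <= t < N ^ n) b j t *: digit_prod f N n t) ->
    forall j t, (j < L)%N -> (t < N ^ n)%N -> b j t = 0.
  elim: L b => // L IHL b.
  rewrite big_nat_recl // expr0 mul1r.
  set r := \sum_(0 <= j < L) _.
  set b0 := \sum_(0 <= t < _) _.
  have [f0 f1] := fY n (ltnSn n).
  set r' := \sum_(0 <= j < L) f n ^+ j *
      \sum_(0 <= t < N ^ n) b j.+1 t *: digit_prod f N n t.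
  have rE : r = f n * r'.
    by rewrite /r mulr_sumr; apply: eq_bigr => j _; rewrite exprS mulrA.
  move=> van.
  (* On [Y n] all terms with a positive power of [f n] are zero, which isolates the constant
     coefficient. *)
  have b00 : forall t, (t < N ^ n)%N -> b 0%N t = 0.
    apply: IH => x Yx; have := van x (sub n (ltnSn n) x Yx).
    by rewrite rE mevalD mevalM (f0 x Yx) mul0r addr0.
  have b0z : b0 = 0.
    by rewrite /b0 big_nat big1 // => t /andP[_ lt]; rewrite b00 // scale0r.
  move: van; rewrite b0z add0r rE => /(prY _ (leqnn _))[//|/IHL vr].
  by case=> [|j] t lj lt; [exact: b00 | exact: (vr j t)].
move=> /(peel N (fun j t => c (j * N ^ n + t)%N)) H t lt.
rewrite (divn_eq t (N ^ n)); apply: H; last by rewrite ltn_mod.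
by rewrite ltn_divLR // -expnS.
Qed.

End Independence.

Section Dimension.
Variable K : fieldType.

Lemma msize_mul_le n (p q : {mpoly K[n]}) a b :
  (msize p <= a.+1)%N -> (msize q <= b.+1)%N -> (msize (p * q) <= (a + b).+1)%N.
Proof.
have [->|p0] := eqVneq p 0; first by rewrite mul0r msize0.
have [->|q0] := eqVneq q 0; first by rewrite mulr0 msize0.
rewrite msizeM // => pa qb; rewrite -subn1 leq_subLR add1n -addSn -addnS.
exact: leq_add.
Qed.

Lemma msize_exp_le n (p : {mpoly K[n]}) a e :
  (msize p <= a.+1)%N -> (msize (p ^+ e) <= (e * a).+1)%N.
Proof.
move=> pa; elim: e => [|e IH]; first by rewrite expr0 msize1.
by rewrite exprS mulSn; apply: msize_mul_le.
Qed.

Lemma msize_prod_le n (I : Type) (r : seq I) (F : I -> {mpoly K[n]}) (a : I -> nat) :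
  (forall i, (msize (F i) <= (a i).+1)%N) ->
  (msize (\prod_(i <- r) F i) <= (\sum_(i <- r) a i).+1)%N.
Proof.
move=> Fa; elim: r => [|i r IH]; first by rewrite !big_nil msize1.
by rewrite !big_cons; apply: msize_mul_le.
Qed.

Lemma card_bmultinom_le k e : (#|{: 'X_{1..k < e.+1}}| <= e.+1 ^ k)%N.
Proof.
pose h (b : 'X_{1..k < e.+1}) : {ffun 'I_k -> 'I_e.+1} := [ffun i => inord (b i)].
have h_inj : injective h.
  have bi (b : 'X_{1..k < e.+1}) i : (b i < e.+1)%N.
    by apply: leq_ltn_trans (bmdeg b); rewrite mdegE (bigD1 i) //= leq_addr.
  move=> b1 b2 /ffunP E; apply/val_inj/mnmP => i /=.
  by have := congr1 val (E i); rewrite !ffunE /= !inordK.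
by have := leq_card h h_inj; rewrite card_ffun !card_ord.
Qed.

(** At most (e + 1) ^ k monomials are available, so the coefficient matrix of more polynomials has a
    nonzero left kernel. *)
Lemma mpoly_dependent k e L (g : nat -> {mpoly K[k]}) :
  (forall t, (t < L)%N -> (msize (g t) <= e.+1)%N) -> (e.+1 ^ k < L)%N ->
  exists c : nat -> K, (exists2 t, (t < L)%N & c t != 0) /\
    \sum_(0 <= t < L) c t *: g t = 0.
Proof.
move=> ge lt.
pose A : 'M[K]_(L, #|{: 'X_{1..k < e.+1}}|) :=
  \matrix_(t, j) (g t)@_(enum_val j : 'X_{1..k < e.+1}).
have kA : kermx A != 0.
  rewrite kermx_eq0 /row_free; apply: contraTneq lt => rA.
  by rewrite -leqNgt -rA (leq_trans (rank_leq_col A)) // card_bmultinom_le.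
have /rowV0Pn[u uA u0] := kA.
exists (fun t => if insub t is Some i then u 0 i else 0); split.
  have /rV0Pn[i ui] := u0; exists i; rewrite ?ltn_ord //.
  by rewrite insubT ?ltn_ord //= => ?; rewrite (_ : Sub _ _ = i) //; apply: val_inj.
rewrite big_mkord; apply/mpolyP => b; rewrite mcoeff0 raddf_sum /=.
case: (ltnP (mdeg b) e.+1) => hb.
  move: uA => /sub_kermxP/rowP/(_ (enum_rank (BMultinom hb))).
  rewrite !mxE => E; rewrite -[RHS]E; apply: eq_bigr => i _.
  by rewrite mcoeffZ mxE enum_rankK /= valK.
apply: big1 => i _; rewrite mcoeffZ [X in _ * X]memN_msupp_eq0 ?mulr0 //.
by apply: msize_mdeg_ge; apply: leq_trans hb; apply: ge.
Qed.

Lemma digit_prod_comp_msize M k f (phi : M.-tuple {mpoly K[k]}) D N n t :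
  (forall i, (i < n)%N -> (msize (f i \mPo phi) <= D.+1)%N) ->
  (t < N ^ n)%N -> (msize (digit_prod f N n t \mPo phi) <= (n * (N * D)).+1)%N.
Proof.
elim: n t => [|n IH] t fD lt /=; first by rewrite rmorph1 msize1.
have N0n : (0 < N ^ n)%N by rewrite expn_gt0; case: N lt {IH} => //; rewrite exp0n.
rewrite rmorphM rmorphXn mulSn addnC /=; apply: msize_mul_le.
  by apply: IH => [i li|]; [apply: fD; exact: ltnW | rewrite ltn_mod].
apply: leq_trans (msize_exp_le _ (fD n (ltnSn n))) _.
by rewrite ltnS leq_mul2r ltnW ?orbT // ltn_divLR // -expnS.
Qed.

(** A polynomial map in k parameters covers [Y n], so a linear relation between the pulled-back
    digit products holds on [Y n] and is trivial by [digit_prod_free]. If n > k, a degree count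
    yields a nontrivial one for large [N]. *)
Lemma chain_le_parameters M k n (Y : nat -> set 'rV[K]_M) (phi : M.-tuple {mpoly K[k]}) :
    Y 0 !=set0 ->
    (forall i, (i < n)%N -> Y i `<=` Y i.+1) ->
    (forall i, (i <= n)%N -> forall p g, vanishing (Y i) (p * g) ->
       vanishing (Y i) p \/ vanishing (Y i) g) ->
    (forall i, (i < n)%N -> exists f, vanishing (Y i) f /\ ~ vanishing (Y i.+1) f) ->
    (forall x, Y n x -> exists u : 'I_k -> K, forall i, x 0 i = (tnth phi i).@[u]) ->
  (n <= k)%N.
Proof.
move=> Y0 sub prY exf par; rewrite leqNgt; apply/negP => ltkn.
have /choice[f fP] : forall i, exists f, (i < n)%N ->
    vanishing (Y i) f /\ ~ vanishing (Y i.+1) f.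
  move=> i; case: (ltnP i n) => [li|_]; last by exists 0.
  by have [f ?] := exf i li; exists f.
pose D := \max_(i < n) msize (f i \mPo phi).
have fD i : (i < n)%N -> (msize (f i \mPo phi) <= D.+1)%N.
  by move=> li; apply: leqW; apply: (leq_bigmax (Ordinal li)).
(* Chosen so that (n N D + 1) ^ k <= (B N) ^ k < N ^ (k + 1) <= N ^ n. *)
pose B := (n * D).+1; pose N := (B ^ k).+1.
have big : ((n * (N * D)).+1 ^ k < N ^ n)%N.
  apply: leq_ltn_trans (_ : ((B * N) ^ k < _)%N).
    case: (posnP k) => [->|k0]; first by rewrite !expn0.
    by rewrite leq_exp2r // (mulnC N) mulnA /B mulSn -add1n leq_add.
  rewrite expnMn; apply: leq_trans (_ : (N ^ k.+1 <= _)%N); last by rewrite leq_pexp2l.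
  by rewrite expnS ltn_mul2r expn_gt0 /N /= ltnSn.
have [c [[t lt /negP ct]]] := mpoly_dependent
  (fun t => digit_prod_comp_msize fD (t := t) (N := N)) big.
move=> dep; apply: ct; apply/eqP.
apply: (digit_prod_free (N := N) _ Y0 sub prY fP) lt => // x /par[u xu].
have -> : (fun i => x 0 i) = (fun i => (tnth phi i).@[u]) by apply: funext.
rewrite -comp_mpoly_meval (_ : _ \mPo _ = 0) ?meval0 // -[RHS]dep raddf_sum /=.
by apply: eq_bigr => i _; rewrite comp_mpolyZ.
Qed.

End Dimension.

(** * Products of linear forms vanishing on grids *)

Section GridProduct.
Variables (m d : nat).
Implicit Type w : m.-tuple 'I_d.+1.

Definition weight w := (\sum_(i < m) tnth w i)%N.

(* Homogeneous of degree d in (t, y) as soon as the weight is at most d; t = 1 *)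
(* is the affine version.                                                     *)
Definition grid_prod (A : comNzRingType) w (a : nat -> A) (t : A) (y : 'I_m -> A) :=
  t ^+ (d - weight w) * \prod_(i < m) \prod_(j < tnth w i) (y i - a j * t).

(** Base change and evaluation are ring morphisms, so the values of a generator over an extension
    are again grid products. *)
Lemma rmorph_grid_prod (A B : comNzRingType) (phi : {rmorphism A -> B}) w a t y :
  phi (grid_prod w a t y) = grid_prod w (phi \o a) (phi t) (phi \o y).
Proof.
rewrite rmorphM rmorphXn rmorph_prod; congr (_ * _); apply: eq_bigr => i _.
by rewrite rmorph_prod; apply: eq_bigr => j _; rewrite rmorphB rmorphM.
Qed.

Lemma grid_prod_eq0 (A : comNzRingType) w a (t : A) y i j :
  (j < tnth w i)%N -> y i = a j * t -> grid_prod w a t y = 0.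
Proof.
move=> lj yE; rewrite /grid_prod (bigD1 i) //= (bigD1 (Ordinal lj)) //=.
by rewrite yE subrr !mul0r mulr0.
Qed.

Definition pure_power (i : 'I_m) : m.-tuple 'I_d.+1 :=
  [tuple (if j == i then ord_max else ord0) | j < m].

Lemma weight_pure_power i : weight (pure_power i) = d.
Proof.
rewrite /weight (bigD1 i) //= tnth_mktuple eqxx /= big1 ?addn0 // => j /negbTE ne.
by rewrite tnth_mktuple ne.
Qed.

Lemma grid_prod_pure_power (A : comNzRingType) a (t : A) y i :
  grid_prod (pure_power i) a t y = \prod_(j < d) (y i - a j * t).
Proof.
rewrite /grid_prod weight_pure_power subnn expr0 mul1r (bigD1 i) //=.
rewrite tnth_mktuple eqxx /= [X in _ * X]big1 ?mulr1 // => j /negbTE ne.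
by rewrite tnth_mktuple ne big_ord0.
Qed.

Lemma weight_lt w w' : w != w' -> (forall i, (tnth w i <= tnth w' i)%N) ->
  (weight w < weight w')%N.
Proof.
move=> ne le; rewrite ltn_neqAle leq_sum // andbT; apply: contra_neq ne => E.
apply/eq_from_tnth => i; apply/val_inj/eqP.
have := leqif_sum (fun i (_ : true) => leqif_eq (le i)).
by move/leqifP; rewrite /weight in E; rewrite E ltnn; case: ifP => // /forallP/(_ i).
Qed.

Variables (F : fieldType) (a : nat -> F).
Hypothesis a_inj : forall i j, (i <= d)%N -> (j <= d)%N -> a i = a j -> i = j.

(** Were w <= v componentwise, v would have the larger weight. So v_i < w_i for some i, and the
    factor y_i - a_(v_i) is zero at a_v. *)
Lemma grid_prod_triangular w v : v != w -> (weight v <= weight w)%N ->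
  grid_prod w a 1 (fun i => a (tnth v i)) = 0.
Proof.
move=> ne le; have [i lt] : exists i, (tnth v i < tnth w i)%N.
  apply/existsP; rewrite -[[exists _, _]]negbK negb_exists.
  apply/negP => /forallP H; have := @weight_lt w v; rewrite eq_sym ne leqNgt in le *.
  move=> /(_ isT) lt; move: le; rewrite lt // => i.
  by rewrite leqNgt.
by apply: (grid_prod_eq0 lt); rewrite mulr1.
Qed.

Lemma grid_prod_diagonal w : grid_prod w a 1 (fun i => a (tnth w i)) != 0.
Proof.
rewrite /grid_prod expr1n mul1r; apply/prodf_neq0 => i _; apply/prodf_neq0 => -[j lj] _.
rewrite mulr1 subr_eq0 /=; apply/eqP => E.
have wd := ltn_ord (tnth w i); rewrite ltnS in wd.
by move: (lj); rewrite -(a_inj wd (leq_trans (ltnW lj) wd) E) ltnn.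
Qed.

Definition grid_aff w : {mpoly F[m]} :=
  grid_prod w (fun j => (a j)%:MP) 1 (fun i => 'X_i).

Definition grid_proj w : {mpoly F[m.+1]} :=
  grid_prod w (fun j => (a j)%:MP) 'X_ord0 (fun i => 'X_(lift ord0 i)).

Lemma meval_grid_aff (K : fieldType) (iota : {rmorphism F -> K}) w x :
  (map_mpoly iota (grid_aff w)).@[x] = grid_prod w (iota \o a) 1 x.
Proof.
rewrite !rmorph_grid_prod !rmorph1; congr grid_prod; apply: funext => i /=.
  by rewrite map_mpolyC mevalC.
by rewrite map_mpolyX mevalXU.
Qed.

Lemma meval_grid_proj (K : fieldType) (iota : {rmorphism F -> K}) w x :
  (map_mpoly iota (grid_proj w)).@[x] =
  grid_prod w (iota \o a) (x ord0) (fun i => x (lift ord0 i)).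
Proof.
rewrite !rmorph_grid_prod /= map_mpolyX mevalXU; congr grid_prod; apply: funext => i /=.
  by rewrite map_mpolyC mevalC.
by rewrite map_mpolyX mevalXU.
Qed.

Lemma msize_grid_aff w : (weight w <= d)%N -> (msize (grid_aff w) <= d.+1)%N.
Proof.
move=> wd; rewrite /grid_aff /grid_prod expr1n mul1r.
apply: leq_trans (_ : ((weight w).+1 <= _)%N); last by [].
apply: msize_prod_le => i.
apply: leq_trans (msize_prod_le (a := fun=> 1%N) _ _) _ => [j|].
  apply: leq_trans (msizeD_le _ _) _; rewrite geq_max msizeX mdeg1 /=.
  by rewrite mulr1 msizeN msizeC; case: (_ != _).
by rewrite sum_nat_const card_ord muln1.
Qed.

Lemma dhomog_bigprod n (I : Type) (r : seq I) (G : I -> {mpoly F[n]}) (e : I -> nat) :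
  (forall i, G i \is (e i).-homog) ->
  \prod_(i <- r) G i \is (\sum_(i <- r) e i)%N.-homog.
Proof.
move=> Gh; elim: r => [|i r IH]; first by rewrite !big_nil dhomog1.
by rewrite !big_cons dhomogM.
Qed.

Lemma dhomogXU n (i : 'I_n) : 'X_i \is [in F[n], 1.-homog].
Proof. by rewrite dhomogX; apply/eqP; exact: mdeg1. Qed.

Lemma dhomog_grid_proj w : (weight w <= d)%N -> grid_proj w \is d.-homog.
Proof.
move=> wd; rewrite /grid_proj /grid_prod.
have hX := dhomogMn (d - weight w) (dhomogXU (@ord0 m)); rewrite mul1n in hX.
suff /(dhomogM hX) : \prod_(i < m) \prod_(j < tnth w i)
    ('X_(lift ord0 i) - (a j)%:MP * 'X_ord0) \is [in F[m.+1], (weight w).-homog].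
  by rewrite subnK.
apply: dhomog_bigprod => i.
have H := @dhomog_bigprod _ _ (index_enum 'I_(tnth w i))
  (fun j => 'X_(lift ord0 i) - (a j)%:MP * 'X_ord0) (fun=> 1%N).
rewrite sum_nat_const card_ord muln1 in H; apply: H => j.
by rewrite mul_mpolyC rpredB ?dhomogXU // dhomogZ // dhomogXU.
Qed.

End GridProduct.

(** * Dimension bounds *)

Section AffineDimension.
Variables (K : fieldType) (m : nat).
Implicit Types (Y : set 'rV[K]_m) (p g : {mpoly K[m]}).
Local Notation closed := (@zariski_closed_affine m K).

Lemma closed_zeros p : closed [set x | p.@[fun i => x 0 i] = 0].
Proof.
by exists [set p]; rewrite predeqE => x; split=> [px q -> //|]; apply.
Qed.

Lemma affine_prime Y : irreducible_set closed Y -> forall p g,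
  vanishing Y (p * g) -> vanishing Y p \/ vanishing Y g.
Proof.
case=> _ irr p g pg; apply: (irr _ _ (closed_zeros p) (closed_zeros g)) => x /pg /eqP.
by rewrite mevalM mulf_eq0 => /orP[] /eqP; [left | right].
Qed.

Lemma affine_proper Y Z : closed Y -> Y `<` Z ->
  exists f, vanishing Y f /\ ~ vanishing Z f.
Proof.
case=> S YE [_ ZY]; have [//|nex] := pselect (exists f, vanishing Y f /\ ~ vanishing Z f).
case: ZY => x Zx; rewrite YE => p Sp; have [van|nv] := pselect (vanishing Z p).
  exact: van.
by case: nex; exists p; split=> // y; rewrite YE; apply.
Qed.

End AffineDimension.

Lemma prime_prod (A : comNzRingType) (P : A -> Prop) (I : Type) (r : seq I) (G : I -> A) :
  ~ P 1 -> (forall p g, P (p * g) -> P p \/ P g) ->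
  P (\prod_(i <- r) G i) -> exists i, P (G i).
Proof.
move=> P1 PM; elim: r => [|i r IH]; first by rewrite big_nil.
by rewrite big_cons => /PM[|/IH //]; exists i.
Qed.

(** By primality one factor of each product vanishes on the largest set of the chain. There the
    first n coordinates are constant, and the last k are parameters. *)
Lemma affine_dim_le (K : fieldType) n k d (a : nat -> K) (X : set 'rV[K]_(n + k)) :
  (forall i : 'I_n, vanishing X (\prod_(j < d) ('X_(lshift k i) - (a j)%:MP))) ->
  dim_le (@zariski_closed_affine _ K) X k.
Proof.
move=> Xa N Y Yirr Ylt.
have prY i : (i <= N)%N -> forall p g, vanishing (Y i) (p * g) ->
    vanishing (Y i) p \/ vanishing (Y i) g.
  by case/Yirr => _ irr _; apply: affine_prime.
have [_ [[x0 Yx0] _] YX] := Yirr N (leqnn N).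
have /choice[c Yc] : forall i : 'I_n, exists c : K,
    forall x, Y N x -> x 0 (lshift k i) = c.
  move=> i; have nv1 : ~ vanishing (Y N) (1 : {mpoly K[n + k]}).
    by move=> /(_ _ Yx0)/eqP; rewrite meval1 oner_eq0.
  have [j van] := prime_prod nv1 (prY N (leqnn N)) (fun x Yx => Xa i x (YX x Yx)).
  exists (a j) => x /van /eqP.
  by rewrite mevalB mevalXU mevalC subr_eq0 => /eqP.
pose phi : (n + k).-tuple {mpoly K[k]} := [tuple
  match split i with inl i' => (c i')%:MP | inr j => 'X_j end | i < n + k].
apply: (@chain_le_parameters _ _ _ _ Y phi) => //.
- by have [_ []] := Yirr 0%N isT.
- by move=> i /Ylt[].
- move=> i lti; apply: affine_proper; last exact: Ylt.
  by have [] := Yirr i (ltnW lti).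
- move=> x Yx; exists (fun j => x 0 (rshift n j)) => i.
  rewrite tnth_mktuple; case: splitP => j ij.
    by rewrite mevalC -(Yc j x Yx); congr (x _ _); apply: val_inj.
  by rewrite mevalXU; congr (x _ _); apply: val_inj.
Qed.

(** * Projective chains through an affine chart *)

Section ProjectiveDimension.
Variables (K : fieldType) (m : nat).
Implicit Types (Y Z : set (projpt m K)) (p g h : {mpoly K[m.+1]}) (v : 'rV[K]_m.+1).
Local Notation closed := (@zariski_closed_proj m K).

Lemma dhomog_meval e h (c : K) (x : 'I_m.+1 -> K) : h \is e.-homog ->
  h.@[fun i => c * x i] = c ^+ e * h.@[x].
Proof.
move=> /dhomogP hh; rewrite !mevalE mulr_sumr; apply: eq_big_seq => b /hh be.
rewrite mulrCA; congr (_ * _); rewrite -be /= mdegE -prodrXr -big_split /=.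
by apply: eq_bigr => i _; rewrite exprMn.
Qed.

Lemma projpt_gen (L : projpt m K) : exists2 v : 'rV[K]_m.+1, v != 0 & (v <= val L)%MS.
Proof.
case: L => L /= /andP[_ /eqP rL].
have : L != 0 by rewrite -mxrank_eq0 rL.
by case/rowV0Pn => v vL v0; exists v.
Qed.

Lemma projpt_scale (L : projpt m K) v v' :
  v != 0 -> (v <= val L)%MS -> (v' <= val L)%MS -> exists c, v' = c *: v.
Proof.
case: L => L /= /andP[_ /eqP rL] v0 vL v'L; apply/sub_rVP.
apply: submx_trans v'L _; have := mxrank_leqif_sup vL.
by move/geq_leqif; rewrite rL lt0n mxrank_eq0 v0 => <-.
Qed.

Lemma proj_root_gen (L : projpt m K) v e h : h \is e.-homog ->
  v != 0 -> (v <= val L)%MS -> h.@[fun i => v 0 i] = 0 -> proj_root h L.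
Proof.
move=> hh v0 vL hv v' v'L; have [c ->] := projpt_scale v0 vL v'L.
rewrite -[RHS](mulr0 (c ^+ e)) -hv -dhomog_meval //.
by apply: meval_eq => i; rewrite mxE.
Qed.

Definition root_on Y p := forall L, Y L -> proj_root p L.

Lemma closed_roots e h : h \is e.-homog -> closed [set L | proj_root h L].
Proof.
move=> hh; exists [set h]; split=> [p ->|]; first by exists e.
by rewrite predeqE => L; split=> [hL p -> //|]; apply.
Qed.

Lemma proj_prime Y e e' h h' : irreducible_set closed Y ->
  h \is e.-homog -> h' \is e'.-homog ->
  root_on Y (h * h') -> root_on Y h \/ root_on Y h'.
Proof.
case=> _ irr hh hh' rhh; apply: (irr _ _ (closed_roots hh) (closed_roots hh')) => L YL.
have [v v0 vL] := projpt_gen L; have /eqP := rhh L YL v vL.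
rewrite mevalM mulf_eq0 => /orP[] /eqP; [left | right].
  exact: (proj_root_gen hh v0 vL).
exact: (proj_root_gen hh' v0 vL).
Qed.

Section Chart.
Variable s : 'I_m.+1.

(** The part of Y off X_s = 0, kept inside K^(m+1) with coordinate s equal to 1 so that [vanishing]
    applies to it. *)
Definition chart Y : set 'rV[K]_m.+1 :=
  [set v : 'rV[K]_m.+1 | v 0 s = 1 /\ exists2 L, Y L & (v <= val L)%MS].

(** Each homogeneous component is multiplied by the power of X_s that completes its degree. *)
Lemma homogenization p : exists e h, h \is e.-homog /\
  forall v : 'rV[K]_m.+1, v 0 s = 1 -> h.@[fun i => v 0 i] = p.@[fun i => v 0 i].
Proof.
exists (msize p), (\sum_(j < msize p) pihomog mdeg j p * 'X_s ^+ (msize p - j)).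
split=> [|v vs].
  apply: rpred_sum => j _.
  have hX := dhomogMn (msize p - j) (dhomogXU K s); rewrite mul1n in hX.
  by have := dhomogM (pihomogP mdeg j p) hX; rewrite subnKC // ltnW.
rewrite [in RHS](pihomog_partitionE (leqnn (msize p))) !raddf_sum /=.
by apply: eq_bigr => j _; rewrite mevalM rmorphXn /= mevalXU vs expr1n mulr1.
Qed.

(** The factor X_s takes care of the points of Y outside the chart. *)
Lemma chart_vanishing Y e h : h \is e.-homog ->
  (vanishing (chart Y) h <-> root_on Y (h * 'X_s)).
Proof.
move=> hh; split=> [van L YL v vL|rt v [vs [L YL vL]]]; last first.
  by have := rt L YL v vL; rewrite mevalM mevalXU vs mulr1.
rewrite mevalM mevalXU; have [->|vs] := eqVneq (v 0 s) 0; first by rewrite mulr0.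
have cv : chart Y ((v 0 s)^-1 *: v).
  by split; [rewrite mxE mulVf | exists L => //; exact: scalemx_sub].
have v0 : (v 0 s)^-1 *: v != 0.
  by apply: contra_neq (oner_neq0 K) => v0; have [<-] := cv; rewrite v0 mxE.
have := proj_root_gen hh v0 (scalemx_sub _ vL) (van _ cv).
by move=> ->; rewrite ?mul0r.
Qed.

(** After homogenization [proj_prime] applies, and X_s cancels because Y is not contained in X_s =
    0. *)
Lemma chart_prime Y : irreducible_set closed Y -> ~ root_on Y 'X_s ->
  forall p g, vanishing (chart Y) (p * g) ->
    vanishing (chart Y) p \/ vanishing (chart Y) g.
Proof.
move=> irr nX p g; have [e [h [hh hp]]] := homogenization p.
have [e' [h' [hh' hg]]] := homogenization g.
have hhh := dhomogM hh hh'.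
have vanE q q' :
    (forall v : 'rV[K]_m.+1, v 0 s = 1 -> q.@[fun i => v 0 i] = q'.@[fun i => v 0 i]) ->
    vanishing (chart Y) q -> vanishing (chart Y) q'.
  by move=> qq van v cv; rewrite -qq ?van //; case: cv.
move=> /(vanE _ (h * h')) van.
have /(chart_vanishing _ hhh) : vanishing (chart Y) (h * h').
  by apply: van => v vs; rewrite !mevalM hp ?hg.
have rtE e0 q : q \is e0.-homog -> root_on Y q -> vanishing (chart Y) q.
  by move=> hq rt v [_ [L YL vL]]; apply: rt vL.
move=> /(proj_prime irr hhh (dhomogXU _ _))[|//] /(proj_prime irr hh hh')[] /rtE rt.
  by left; apply: (vanE h) => //; apply: rt hh.
by right; apply: (vanE h') => //; apply: rt hh'.
Qed.

(** An equation of Y that vanishes on the chart of Z vanishes on Z once X_s is cancelled; if all of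
    them did, Z would lie in Y. *)
Lemma chart_proper Y Z : closed Y -> irreducible_set closed Z -> Y `<` Z ->
  ~ root_on Z 'X_s -> exists f, vanishing (chart Y) f /\ ~ vanishing (chart Z) f.
Proof.
move=> [S [Sh YE]] irr [_ ZY] nX.
have [//|nex] := pselect (exists f, vanishing (chart Y) f /\ ~ vanishing (chart Z) f).
case: ZY => L ZL; rewrite YE => p Sp; have [e hp] := Sh p Sp.
have [/(chart_vanishing _ hp)|nv] := pselect (vanishing (chart Z) p).
  by move=> /(proj_prime irr hp (dhomogXU _ _))[|//]; apply.
case: nex; exists p; split=> // v [_ [L' YL' vL']].
by move: YL'; rewrite YE => /(_ p Sp); apply.
Qed.

End Chart.
End ProjectiveDimension.

(** By primality n of the coordinates are fixed multiples of X_0 on the largest set. A chart that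
    meets [Y 0] meets the whole chain and leaves k parameters. *)
Lemma proj_dim_le (K : fieldType) n k d (a : nat -> K) (X : set (projpt (n + k) K)) :
  (forall i : 'I_n, root_on X
    (\prod_(j < d) ('X_(lift ord0 (lshift k i)) - (a j)%:MP * 'X_ord0))) ->
  dim_le (@zariski_closed_proj _ K) X k.
Proof.
move=> Xa N Y Yirr Ylt.
have irr i : (i <= N)%N -> irreducible_set (@zariski_closed_proj _ K) (Y i).
  by case/Yirr.
have [_ [[L1 YL1] _] YX] := Yirr N (leqnn N).
have hlin i (c : K) : 'X_(lift ord0 (lshift k i)) - c%:MP * 'X_ord0
    \is [in K[(n + k).+1], 1.-homog].
  by rewrite mul_mpolyC rpredB ?dhomogXU // dhomogZ // dhomogXU.
have /choice[c Yc] : forall i : 'I_n, exists c : K,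
    forall L, Y N L -> forall v : 'rV_ _, (v <= val L)%MS ->
      v 0 (lift ord0 (lshift k i)) = c * v 0 ord0.
  move=> i; pose G (j : 'I_d) := 'X_(lift ord0 (lshift k i)) - (a j)%:MP * 'X_ord0.
  have : root_on (Y N) (\prod_(j < d) G j) by move=> L YL; apply: Xa; apply: YX.
  have : forall r : seq 'I_d, root_on (Y N) (\prod_(j <- r) G j) ->
      exists j, root_on (Y N) (G j).
    elim=> [|j r IH].
      rewrite big_nil => /(_ L1 YL1) rt.
      by have := rt 0; rewrite sub0mx => /(_ isT)/eqP; rewrite meval1 oner_eq0.
    rewrite big_cons => /(proj_prime (irr N (leqnn N)) (hlin _ _)
      (dhomog_bigprod r (fun j => hlin i (a j))))[|/IH //].
    by exists j.
  move=> H /H[j rt]; exists (a j) => L YL v vL; apply/eqP.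
  by have /eqP := rt L YL v vL; rewrite mevalB mevalM mevalC !mevalXU subr_eq0.
(* X_0 and the last k coordinates determine the others, hence do not all vanish *)
(* at a point of Y 0; the chart is chosen among them.                          *)
pose J (j : 'I_k.+1) : 'I_(n + k).+1 :=
  if unlift ord0 j is Some j' then lift ord0 (rshift n j') else ord0.
have [_ [[L0 YL0] _] _] := Yirr 0%N isT.
have Ysub i j : (i <= j <= N)%N -> Y i `<=` Y j.
  elim: j => [|j IH]; first by rewrite leqn0 => /andP[/eqP-> _].
  rewrite leq_eqVlt => /andP[/orP[/eqP->|ij] jN]; first by [].
  by move=> L YL; apply: (proj1 (Ylt j jN)); apply: (IH _ L YL); rewrite -ltnS ij ltnW.
have [v0 v0n0 v0L] := projpt_gen L0.
have [t v0t] : exists t, v0 0 (J t) != 0.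
  apply/existsP; rewrite -[[exists _, _]]negbK negb_exists; apply/negP => /forallP v00.
  have {}v00 t : v0 0 (J t) = 0 by apply/eqP; rewrite -[_ == _]negbK.
  have vz : v0 0 ord0 = 0 by have := v00 ord0; rewrite /J unlift_none.
  move/eqP: v0n0; apply; apply/rowP => i; rewrite mxE.
  case: (unliftP ord0 i) => [i'|] -> //.
  rewrite -(splitK i'); case: (split i') => j /=.
    by rewrite (Yc j L0) ?vz ?mulr0 //; apply: (Ysub 0%N N) YL0; rewrite leqnn.
  by have := v00 (lift ord0 j); rewrite /J liftK.
have nX i : (i <= N)%N -> ~ root_on (Y i) 'X_(J t).
  move=> iN rt; move/eqP: v0t; apply.
  by rewrite -(mevalXU (fun i => v0 0 i)); apply: (rt L0) v0L; apply: (Ysub 0%N i).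
(* Coordinate [J t] is 1 on the chart; the k other coordinates [J j] are the parameters. *)
pose psi (j : 'I_k.+1) : {mpoly K[k]} := if unlift t j is Some j' then 'X_j' else 1.
pose phi : (n + k).+1.-tuple {mpoly K[k]} := [tuple
  if unlift ord0 i is Some i' then
    match split i' with
    | inl i'' => (c i'')%:MP * psi ord0
    | inr j => psi (lift ord0 j)
    end
  else psi ord0 | i < (n + k).+1].
apply: (@chain_le_parameters _ _ _ _ (fun i => chart (J t) (Y i)) phi).
- exists ((v0 0 (J t))^-1 *: v0); split; first by rewrite mxE mulVf.
  by exists L0 => //; apply: scalemx_sub.
- by move=> i /Ylt[sub _] v [vs [L /sub YL vL]]; split=> //; exists L.
- by move=> i iN; apply: chart_prime; [exact: irr | exact: nX].
- move=> i lti; have [cl _ _] := Yirr i (ltnW lti).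
  by apply: chart_proper => //; [exact: irr | exact: Ylt | exact: nX].
move=> v [vs [L YL vL]]; exists (fun j => v 0 (J (lift t j))).
have psiE j : (psi j).@[fun j => v 0 (J (lift t j))] = v 0 (J j).
  by rewrite /psi; case: unliftP => [j' ->|->]; rewrite ?mevalXU ?meval1.
move=> i; rewrite tnth_mktuple; case: unliftP => [i' ->|->]; last first.
  by rewrite psiE /J unlift_none.
case: splitP => j ij.
  rewrite mevalM mevalC psiE /J unlift_none -(Yc j L) //.
  by congr (v _ (lift _ _)); apply: val_inj.
by rewrite psiE /J liftK; congr (v _ (lift _ _)); apply: val_inj.
Qed.

(** * Lexicographic counting *)

Section Exponents.
Local Close Scope classical_set_scope.
Local Open Scope nat_scope.

Section Counting.
Variables (m q : nat) (sz : 'I_m -> nat).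
Hypothesis szq : forall i, sz i <= q.

Lemma card_ord_lt t : t <= q -> #|[pred c : 'I_q | c < t]| = t.
Proof.
move=> tq; rewrite -sum1_card -[RHS]card_ord -sum1_card.
by rewrite (big_ord_widen q (fun=> 1)).
Qed.

Lemma card_family_prod (I T : finType) (P : I -> pred T) :
  #|family P| = \prod_i #|P i|.
Proof. by rewrite card_family foldrE big_map big_enum. Qed.

(* Mixed-radix expansion: the box elements below alpha are sorted by the      *)
(* first index at which they are smaller.                                     *)
Lemma card_lex_below (alpha : 'I_m -> nat) (Z : {set {ffun 'I_m -> 'I_q}}) :
  (forall i : 'I_m, 0 < alpha i -> alpha i <= sz i /\ forall j : 'I_m, j < i -> alpha j < sz j) ->
  (forall (b : {ffun 'I_m -> 'I_q}) (i : 'I_m), (forall j, b j < sz j) ->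
    (forall j : 'I_m, j < i -> b j = alpha j :> nat) ->
    b i < alpha i -> b \in Z) ->
  \sum_(i < m) alpha i * \prod_(j < m | i < j) sz j <= #|Z|.
Proof.
move=> asz aZ.
(* [C i] fixes the entries before i to those of alpha, takes a smaller one at i, and is free in the
   box after i. The minimum keeps entry i inside the box. *)
pose P (i j : 'I_m) : pred 'I_q := [pred c : 'I_q |
  if j < i then (c == alpha j :> nat) && (c < sz j)
  else if j == i then c < minn (alpha i) (sz i) else c < sz j].
pose C (i : 'I_m) : {set {ffun 'I_m -> 'I_q}} := [set b in family (P i)].
have CP i b : b \in C i -> [/\ forall j, b j < sz j,
    forall j : 'I_m, j < i -> b j = alpha j :> nat & b i < alpha i].
  rewrite inE => /familyP bP; split=> [j|j ji|].
  - have := bP j; rewrite !inE; case: ifP => _; first by case/andP.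
    by case: eqP => [->|//]; rewrite leq_min => /andP[].
  - by have := bP j; rewrite !inE ji => /andP[/eqP].
  - by have := bP i; rewrite !inE ltnn eqxx leq_min => /andP[].
have disj i j : i != j -> [disjoint C i & C j].
  have lt (i' j' : 'I_m) : i' < j' -> [disjoint C i' & C j'].
    move=> ij; rewrite finset.disjoints_subset; apply/fintype.subsetP => b /CP[_ _ bi].
    rewrite inE; apply/negP => /CP[_ /(_ i' ij) bi' _].
    by rewrite bi' ltnn in bi.
  by rewrite neq_ltn => /orP[] /lt; rewrite // disjoint_sym.
apply: leq_trans (_ : #|(\bigcup_i C i)| <= _); last first.
  apply/subset_leq_card/fintype.subsetP => b /bigcupP[i _ /CP[b1 b2 b3]].
  exact: aZ b1 b2 b3.
rewrite -sum1_card partition_disjoint_bigcup //; apply: leq_sum => i _.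
rewrite sum1_card; have [->|a0] := posnP (alpha i); first by rewrite mul0n.
have [ai aj] := asz i a0.
rewrite cardsE card_family_prod [X in _ <= X](bigD1 i) //=.
rewrite [X in _ <= X * _](_ : _ = alpha i); last first.
  rewrite -[RHS](card_ord_lt (leq_trans ai (szq i))); apply: eq_card => c.
  by rewrite !inE ltnn eqxx (minn_idPl ai).
rewrite leq_mul2l; apply/orP; right.
rewrite big_mkcond [X in X <= _](bigD1 i) //= ltnn mul1n.
apply: leq_prod => j ji; have [ij|] := ltnP i j.
  rewrite -[X in X <= _](card_ord_lt (szq j)); apply/eq_leq/eq_card => c.
  by rewrite !inE [j < i]ltnNge (ltnW ij) /= (negbTE ji).
rewrite leq_eqVlt -[_ == _]/(j == i) (negbTE ji) /= => lji.
have cq : alpha j < q by apply: leq_trans (aj _ lji) (szq j).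
rewrite -(card1 (Ordinal cq)); apply/eq_leq/eq_card => c; rewrite !inE lji.
by rewrite -val_eqE /=; case: eqP => //= ->; rewrite aj.
Qed.

End Counting.

(** * The exponents of W and their footprint *)

Section Footprint.
Variables (n k d q : nat).
Hypotheses (n0 : 0 < n) (d0 : 0 < d) (dq : d < q).
Local Notation m := (n + k).
Local Notation Omega := (Omega' d m k q).
Local Notation size_ i := (if i < n then d else q).
Local Notation tup := (m.-tuple 'I_d.+1).

Definition omega_desc : seq (m.-tuplelexi 'I_d.+1) := sort >=%O (enum Omega).

Lemma in_Omega (w : m.-tuplelexi 'I_d.+1) : w \in Omega ->
  (forall i, tnth w i < size_ i) /\ weight w <= d.
Proof.
rewrite inE => /andP[/forallP wi wd]; split=> // i.
by have := wi i; rewrite addnK.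
Qed.

Lemma pure_power_inj : injective (pure_power d : 'I_m -> tup).
Proof.
move=> i j /(congr1 (fun t => nat_of_ord (tnth t i))); rewrite !tnth_mktuple eqxx.
by case: eqP => //= _ dz; have := d0; rewrite dz.
Qed.

Lemma pure_power_notin (i : 'I_n) : (pure_power d (lshift k i) : tup) \notin Omega.
Proof.
apply/negP => /in_Omega[/(_ (lshift k i))]; rewrite tnth_mktuple eqxx /= ltn_ord.
by rewrite ltnn.
Qed.

(** A vector of weight at most d outside [Omega'] has an entry >= d at some i < n, since no entry
    reaches q > d, and the weight forces it to be d e_i. So at most n vectors are missing. *)
Lemma card_Omega : 'C(m + d, d) - n <= #|Omega|.
Proof.
rewrite leq_subLR -(bin_sub (leq_addl _ _)) addnK -card_partial_ord_partitions.
pose E := [set pure_power d (lshift k i) | i : 'I_n].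
have cE : #|E| <= n by rewrite -[X in _ <= X]card_ord leq_imset_card.
apply: leq_trans (_ : #|E :|: (Omega : {set tup})| <= _); last first.
  by apply: leq_trans (leq_card_setU _ _) _; rewrite leq_add2r.
apply/subset_leq_card/fintype.subsetP => w; rewrite !inE big_tuple => wd.
rewrite wd andbT; apply/orP.
case: (altP forallP) => [_|]; [by right | rewrite negb_forall => /existsP[i]].
rewrite -leqNgt addnK => wi; left.
have wid : tnth w i <= weight w by rewrite /weight (bigD1 i) //= leq_addr.
have ltin : i < n.
  move: wi; case: ifP => // _ wq; have := leq_trans wq (leq_trans wid wd).
  by rewrite leqNgt dq.
rewrite ltin in wi; apply/imsetP; exists (Ordinal ltin) => //.
have wE : tnth w i = d :> nat.
  by apply/eqP; rewrite eqn_leq wi andbT (leq_trans wid wd).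
have li : lshift k (Ordinal ltin) = i by apply: val_inj.
apply/eq_from_tnth => j; rewrite tnth_mktuple li; apply: val_inj.
case: eqP => [->|/eqP ji] //=; move: wd.
rewrite (bigD1 i) //= wE (bigD1 j) //= -[X in _ <= X]addn0 leq_add2l leqn0.
by rewrite addn_eq0 => /andP[/eqP].
Qed.

Variable r : nat.
Hypotheses (nr : n <= r) (rC : r <= 'C(m + d, d)).

Definition alpha : tup := w' d m k q (r - n).

Definition exponents : seq tup :=
  [seq pure_power d (lshift k i) | i <- enum 'I_n] ++ take (r - n) omega_desc.

Lemma size_omega_desc : r - n <= size omega_desc.
Proof.
rewrite size_sort -cardE; apply: leq_trans card_Omega; exact: leq_sub2r.
Qed.

Lemma size_exponents : size exponents = r.
Proof.
by rewrite size_cat size_map size_enum_ord size_takel ?size_omega_desc // subnKC.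
Qed.

Lemma mem_take_Omega w : w \in take (r - n) omega_desc -> w \in Omega.
Proof. by move/mem_take; rewrite mem_sort mem_enum. Qed.

Lemma uniq_exponents : uniq exponents.
Proof.
rewrite cat_uniq take_uniq ?sort_uniq ?enum_uniq // andbT map_inj_uniq ?enum_uniq /=.
  apply/hasPn => w /mem_take_Omega wO; apply/negP => /mapP[i _ wE].
  by have := pure_power_notin i; rewrite -wE wO.
by move=> i j /pure_power_inj /lshift_inj.
Qed.

Lemma exponents_weight w : w \in exponents -> weight w <= d.
Proof.
rewrite mem_cat => /orP[/mapP[i _ ->]|/mem_take_Omega/in_Omega[]//].
by rewrite weight_pure_power.
Qed.

Lemma mem_exponents_pure (i : 'I_n) : pure_power d (lshift k i) \in exponents.
Proof. by rewrite mem_cat; apply/orP; left; apply/mapP; exists i; rewrite ?mem_enum. Qed.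

Lemma alphaE : n < r -> alpha = nth (w'0 d m) omega_desc (r - n).-1.
Proof. by rewrite -subn_gt0 /alpha /w'; case: (r - n). Qed.

(** Here p is the first index at which alpha and w differ, with p = m when they are equal. *)
Lemma exponents_ge w : w \in take (r - n) omega_desc ->
  exists p : 'I_m.+1, forall i : 'I_m, i <= p ->
    tnth alpha i <= tnth w i ?= iff (i != p :> nat).
Proof.
move=> wT; have nlr : n < r.
  by rewrite -subn_gt0; move: wT; case: (r - n) => //; rewrite take0.
have sr : 0 < r - n by rewrite subn_gt0.
suff : @Order.le _ (m.-tuplelexi 'I_d.+1) alpha w.
  move/Order.TupleLexiOrder.lexi_tupleP => [p pP]; exists p => i /pP[le eq].
  by split.
have lt : index w (take (r - n) omega_desc) < r - n.
  by move: wT; rewrite -index_mem size_takel ?size_omega_desc.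
rewrite alphaE // -(nth_index (w'0 d m) wT) nth_take //.
have tot : total (>=%O : rel (m.-tuplelexi 'I_d.+1)) by move=> x y; exact: le_total.
have tr : transitive (>=%O : rel (m.-tuplelexi 'I_d.+1)).
  by move=> x y z yx xz; exact: le_trans xz yx.
apply: (sorted_leq_nth tr _ _ (sort_sorted tot _)); rewrite ?inE.
- exact: lexx.
- exact: leq_trans lt size_omega_desc.
- by apply: leq_trans size_omega_desc; rewrite prednK.
- by rewrite -ltnS prednK.
Qed.

(** For r > n, alpha lies in [Omega'] and the bounds are strict. For r = n it is (d, 0, ..., 0),
    whose first entry attains its bound. *)
Lemma alpha_size (i : 'I_m) : 0 < tnth alpha i ->
  tnth alpha i <= size_ i /\ forall j : 'I_m, j < i -> tnth alpha j < size_ j.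
Proof.
have [rn|nlr] := leqP r n.
  rewrite /alpha (eqP (_ : r - n == 0)) ?subn_eq0 // tnth_mktuple.
  by case: eqP => // -> _; rewrite n0.
have /in_Omega[aO _] : (alpha : m.-tuplelexi 'I_d.+1) \in Omega.
  rewrite alphaE // -mem_enum -(mem_sort >=%O) mem_nth //.
  by apply: leq_trans size_omega_desc; rewrite prednK // subn_gt0.
by move=> _; split=> [|j _]; [apply/ltnW/aO | apply: aO].
Qed.

Lemma prod_size (i : 'I_m) : \prod_(j < m | i < j) (size_ j) =
  if i.+1 < n then d ^ (n - i.+1) * q ^ k else q ^ (m - i.+1).
Proof.
have -> : \prod_(j < m | i < j) (size_ j) = \prod_(i.+1 <= j < m) (size_ j).
  by rewrite big_geq_mkord.
case: ifP => [ltin|/negbT]; last rewrite -leqNgt => lein.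
  rewrite (big_cat_nat (n := n)) ?(ltnW ltin) ?leq_addr //=; congr (_ * _).
    rewrite -prod_nat_const_nat big_nat [RHS]big_nat.
    by apply: eq_bigr => j /andP[_ ->].
  rewrite -[X in q ^ X](addKn n) -prod_nat_const_nat big_nat [RHS]big_nat.
  by apply: eq_bigr => j /andP[nj _]; rewrite ltnNge nj.
rewrite -prod_nat_const_nat big_nat [RHS]big_nat; apply: eq_bigr => j /andP[ij _].
by rewrite ltnNge (leq_trans lein ij).
Qed.

(* At r = n the convention w'_0 = (d, 0, ..., 0) makes the sum equal to         *)
(* d ^ n * q ^ k.                                                              *)
Lemma f_AE : f_A d m k q r = \sum_(i < m) tnth alpha i * \prod_(j < m | i < j) (size_ j).
Proof.
have sumE : \sum_(i < m) tnth alpha i * \prod_(j < m | i < j) (size_ j) =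
    \sum_(i < m | i.+1 <= n - 1) tnth alpha i * d ^ (n - i.+1) * q ^ k
  + \sum_(i < m | n <= i.+1) tnth alpha i * q ^ (m - i.+1).
  rewrite (bigID (fun i : 'I_m => i.+1 < n)) /=; congr (_ + _).
    apply: eq_big => [i|i lt]; first by rewrite subn1 -[RHS]ltnS prednK.
    by rewrite prod_size lt mulnA.
  apply: eq_big => [i|i /negbTE lt]; first by rewrite -leqNgt.
  by rewrite prod_size lt.
rewrite /f_A addnK; case: eqP => [rn|_]; last by rewrite sumE.
have m0 : 0 < m by rewrite addn_gt0 n0.
rewrite (bigD1 (op := addn) (Ordinal m0)) // [X in _ = _ + X]big1 ?addn0 => [|i ne]; last first.
  by rewrite -val_eqE /= in ne; rewrite /alpha rn subnn tnth_mktuple (negbTE ne).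
rewrite prod_size /alpha rn subnn tnth_mktuple eqxx /=.
case: ifP => [_|]; first by rewrite mulnA -expnS subn1 prednK.
move/negbT; rewrite -leqNgt => n1.
have nE : n = 1 by apply/eqP; rewrite eqn_leq n0 andbT.
by rewrite nE expn1 addKn.
Qed.

(** Indices b of grid points at which every generator has a zero factor, that is b_i < w_i for some
    i; for w = d e_i this reads b_i < d. *)
Definition footprint : {set {ffun 'I_m -> 'I_q}} :=
  [set b : {ffun 'I_m -> 'I_q} | [forall i : 'I_n, b (lshift k i) < d] &&
    all (fun w : tup => [exists i, b i < tnth w i]) (take (r - n) omega_desc)].

(** Let b first drop below alpha at i, and let w first exceed alpha at p. Then b_i < w_i if i <= p,
    and b_p = alpha_p < w_p otherwise. *)
Lemma f_A_le_footprint : f_A d m k q r <= #|footprint|.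
Proof.
rewrite f_AE; apply: (@card_lex_below m q (fun j : 'I_m => size_ j)) => [i|i|b i bsz beq blt].
- by case: ifP => _ //; exact: ltnW.
- exact: alpha_size.
rewrite inE; apply/andP; split.
  by apply/forallP => j; have := bsz (lshift k j); rewrite /= ltn_ord.
apply/allP => w /exponents_ge[p pP]; apply/existsP.
have [ip|pi] := leqP i p.
  by exists i; apply: leq_trans blt (pP i ip).1.
have pm : p < m by apply: ltn_trans pi _.
exists (Ordinal pm); rewrite beq //=.
by have := pP (Ordinal pm) (leqnn _); rewrite /= eqxx => /ltn_leqif ->.
Qed.

Lemma footprintP b w : b \in footprint -> w \in exponents -> exists i, b i < tnth w i.
Proof.
rewrite inE => /andP[/forallP bd /allP bT]; rewrite mem_cat => /orP[/mapP[i _ ->]|/bT/existsP//].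
by exists (lshift k i); rewrite tnth_mktuple eqxx.
Qed.

Local Notation lead := (lead_index d m k q r).

(** Since alpha_l > 0, a vector lexicographically at least alpha has a positive entry at or before
    l. *)
Lemma exponents_lead w : lead <= m -> w \in exponents ->
  exists2 i : 'I_m, i < maxn lead n & 0 < tnth w i.
Proof.
move=> lm; rewrite mem_cat => /orP[/mapP[i _ ->]|/exponents_ge[p pP]].
  by exists (lshift k i); rewrite ?tnth_mktuple ?eqxx // leq_max /= ltn_ord orbT.
rewrite /lead_index addnK -/alpha in lm *.
set l := find _ _ in lm *; pose li := Ordinal lm.
have al : 0 < tnth alpha li.
  rewrite lt0n (tnth_nth ord0) /=.
  by apply: (@nth_find _ ord0 (fun a : 'I_d.+1 => a != 0 :> nat)); rewrite has_find size_tuple.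
have [lp|pl] := leqP l p.
  by exists li; [rewrite leq_max ltnSn | apply: leq_trans al (pP li lp).1].
have pm : p < m by apply: ltn_trans pl lm.
exists (Ordinal pm); first by rewrite leq_max ltnS (ltnW pl).
have := pP (Ordinal pm) (leqnn _); rewrite /= eqxx => /ltn_leqif.
by move/(leq_ltn_trans (leq0n _)).
Qed.

(** As k = m - n, the minimum s is m - max(l, n) - 1. When s < 0 the truncated exponent is 0 and the
    quotient vanishes. *)
Lemma f_PE : f_P d m k q r = f_A d m k q r + (q ^ (m - maxn lead n) - 1) %/ (q - 1).
Proof.
rewrite /f_P; congr (_ + _); set l := lead_index _ _ _ _ _.
set s := Order.min _ _.
have sE : s = ((m - maxn l n)%:Z - 1)%R \/ (s < 0)%R /\ m - maxn l n = 0 by lia.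
case: sE => [sE|[]]; last by case: (s) => // j _ ->; rewrite expn0 subnn div0n.
case: (m - maxn l n) sE => [|e] ->; first by rewrite expn0 subnn div0n.
by rewrite -[e.+1]addn1 PoszD addrK addn1.
Qed.

End Footprint.
End Exponents.

(** * The extremal spaces *)

Section LinearAlgebra.
Variables (F : fieldType) (V : vectType F).

Lemma span_ind (P : V -> Prop) (X : seq V) :
  P 0 -> (forall c u v, P u -> P v -> P (c *: u + v)) ->
  (forall x, x \in X -> P x) -> forall v, v \in <<X>>%VS -> P v.
Proof.
move=> P0 PD PX v /(coord_span (X := in_tuple X)) ->.
elim/big_rec: _ => // i u _ Pu; apply: PD => //.
by apply: PX; rewrite mem_nth.
Qed.

(** Induction on the rank: in a relation evaluated at v, terms of smaller rank have zero
    coefficients already, and the others are killed by [ev v], except v itself. *)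
Lemma triangular_free (I : eqType) (T : seq I) (rk : I -> nat) (B : I -> V)
    (ev : I -> V -> F) :
    (forall v n (c : 'I_n -> F) (p : 'I_n -> V),
       ev v (\sum_i c i *: p i) = \sum_i c i * ev v (p i)) ->
    uniq T -> {in T, forall v, ev v (B v) != 0} ->
    {in T &, forall v w, v != w -> (rk v <= rk w)%N -> ev v (B w) = 0} ->
  free [seq B w | w <- T].
Proof.
move=> lin uT diag tri.
pose X := [tuple of [seq B w | w <- in_tuple T]].
rewrite -[map B T]/(tval X); apply/freeP => c sum0 i.
pose t := tnth (in_tuple T); have tT j : t j \in T by exact: mem_tnth.
have {}sum0 : \sum_j c j *: B (t j) = 0.
  by rewrite -[RHS]sum0; apply: eq_bigr => j _; rewrite -tnth_nth tnth_map.
have [N le] := ubnP (rk (t i)); elim: N => // N IH in i le *.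
have ev0 : ev (t i) 0 = 0.
  by have := lin (t i) 0%N (fun=> 0) (fun=> 0); rewrite !big_ord0.
have := lin (t i) _ c (fun j => B (t j)); rewrite sum0 ev0.
rewrite (bigD1 i) //= big1 ?addr0 => [/esym/eqP|j ji].
  by rewrite mulf_eq0 (negbTE (diag _ (tT i))) orbF => /eqP.
have tij : t i != t j by rewrite (inj_eq (tuple_uniqP (in_tuple T) uT)) eq_sym.
have [ij|ji'] := leqP (rk (t i)) (rk (t j)).
  by rewrite [ev _ _]tri ?mulr0.
by rewrite IH ?mul0r // (leq_trans ji').
Qed.

End LinearAlgebra.

Section Construction.
Local Close Scope classical_set_scope.
Variables (F : finFieldType) (n k d r : nat).
Hypotheses (n0 : (0 < n)%N) (d0 : (0 < d)%N) (dq : (d < #|F|)%N).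
Hypotheses (nr : (n <= r)%N) (rC : (r <= 'C(n + k + d, d))%N).
Local Notation m := (n + k)%N.
Local Notation q := #|F|.
Local Notation tup := (m.-tuple 'I_d.+1).
Local Notation T := (exponents n k d q r).

Definition felt (j : nat) : F := nth 0 (enum F) j.

Lemma felt_inj i j : (i < q)%N -> (j < q)%N -> felt i = felt j -> i = j.
Proof.
by rewrite !cardE => li lj /eqP; rewrite nth_uniq ?enum_uniq // => /eqP.
Qed.

Lemma felt_inj_le i j : (i <= d)%N -> (j <= d)%N -> felt i = felt j -> i = j.
Proof. by move=> id jd; apply: felt_inj; exact: leq_ltn_trans dq. Qed.

(** The default 0 of [insubd] is never taken on the exponents of W, whose weight is at most d. *)
Definition aff_gen (w : tup) : degle m F d := insubd 0 (grid_aff felt w).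
Definition proj_gen (w : tup) : dhomog m.+1 F d := insubd 0 (grid_proj felt w).

Lemma val_aff_gen w : w \in T -> val (aff_gen w) = grid_aff felt w.
Proof.
move=> /exponents_weight wd; rewrite val_insubd ifT // inE.
by apply: msize_grid_aff; exact: wd.
Qed.

Lemma val_proj_gen w : w \in T -> val (proj_gen w) = grid_proj felt w.
Proof.
move=> /exponents_weight wd; rewrite val_insubd ifT //.
by apply: dhomog_grid_proj; exact: wd.
Qed.

Definition aff_span : {vspace degle m F d} := <<[seq aff_gen w | w <- T]>>%VS.
Definition proj_span : {vspace dhomog m.+1 F d} := <<[seq proj_gen w | w <- T]>>%VS.

Lemma map_mpoly_idfun N (p : {mpoly F[N]}) : map_mpoly idfun p = p.
Proof. by apply/mpolyP => b; rewrite mcoeff_map_mpoly. Qed.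

Lemma dim_aff_span : \dim aff_span = r.
Proof.
rewrite -[RHS](size_exponents dq nr rC) -(size_map aff_gen); apply/eqP.
apply: (@triangular_free _ _ _ _ (@weight m d) _
  (fun v (p : degle m F d) => (val p).@[fun i => felt (tnth v i)])).
- move=> v N c p; rewrite !raddf_sum; apply: eq_bigr => i _.
  by rewrite /= linearZ.
- exact: uniq_exponents.
- move=> v vT; rewrite val_aff_gen // -[grid_aff _ _]map_mpoly_idfun meval_grid_aff.
  exact: (grid_prod_diagonal felt_inj_le).
- move=> v w vT wT vw le; rewrite val_aff_gen // -[grid_aff _ _]map_mpoly_idfun.
  by rewrite meval_grid_aff; apply: grid_prod_triangular.
Qed.

Definition homvec (t : F) (y : 'I_m -> F) : 'rV[F]_m.+1 :=
  \row_i (if unlift ord0 i is Some j then y j else t).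

Lemma homvec0 t y : homvec t y 0 ord0 = t.
Proof. by rewrite mxE unlift_none. Qed.

Lemma homvec_lift t y i : homvec t y 0 (lift ord0 i) = y i.
Proof. by rewrite mxE liftK. Qed.

Lemma dim_proj_span : \dim proj_span = r.
Proof.
rewrite -[RHS](size_exponents dq nr rC) -(size_map proj_gen); apply/eqP.
apply: (@triangular_free _ _ _ _ (@weight m d) _
  (fun v (p : dhomog m.+1 F d) => (val p).@[homvec 1 (fun i => felt (tnth v i)) 0])).
- move=> v N c p; rewrite !raddf_sum; apply: eq_bigr => i _.
  by rewrite /= linearZ.
- exact: uniq_exponents.
- move=> v vT; rewrite val_proj_gen // -[grid_proj _ _]map_mpoly_idfun meval_grid_proj.
  rewrite homvec0 (_ : (fun i => _) = fun i => felt (tnth v i)).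
    exact: (grid_prod_diagonal felt_inj_le).
  by apply: funext => i; rewrite homvec_lift.
- move=> v w vT wT vw le; rewrite val_proj_gen // -[grid_proj _ _]map_mpoly_idfun.
  rewrite meval_grid_proj homvec0 (_ : (fun i => _) = fun i => felt (tnth v i)).
    by apply: grid_prod_triangular.
  by apply: funext => i; rewrite homvec_lift.
Qed.

Lemma aff_span_dim_le (K : fieldType) (iota : {rmorphism F -> K}) :
  dim_le (@zariski_closed_affine m K) (Zset iota aff_span) k.
Proof.
apply: (@affine_dim_le _ _ _ d (iota \o felt)) => i x Zx.
have iT := mem_exponents_pure k d q r i.
have := Zx _ (memv_span (map_f aff_gen iT)).
rewrite val_aff_gen // meval_grid_aff grid_prod_pure_power => H.
rewrite -[RHS]H rmorph_prod; apply: eq_bigr => j _ /=.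
by rewrite mevalB mevalXU mevalC mulr1.
Qed.

Lemma proj_span_dim_le (K : fieldType) (iota : {rmorphism F -> K}) :
  dim_le (@zariski_closed_proj m K) (Vset iota proj_span) k.
Proof.
apply: (@proj_dim_le _ _ _ d (iota \o felt)) => i L VL v vL.
have iT := mem_exponents_pure k d q r i.
have := VL _ (memv_span (map_f proj_gen iT)) v vL.
rewrite val_proj_gen // meval_grid_proj grid_prod_pure_power => H.
rewrite -[RHS]H rmorph_prod; apply: eq_bigr => j _ /=.
by rewrite mevalB mevalM mevalC !mevalXU.
Qed.

(** Some linear factor of the product of w vanishes at (t, y). *)
Definition grid_zero (w : tup) (t : F) (y : 'I_m -> F) :=
  exists i (j : nat), (j < tnth w i)%N /\ y i = felt j * t.

Lemma aff_zero (x : 'rV[F]_m) :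
  (forall w, w \in T -> grid_zero w 1 (fun i => x 0 i)) -> Zset idfun aff_span x.
Proof.
move=> xT; apply: (@span_ind _ _ (fun p : degle m F d =>
  (map_mpoly idfun (val p)).@[fun i => x 0 i] = 0)) => [|c u v|_ /mapP[w wT ->]].
- by rewrite !raddf0.
- by rewrite linearP /= !map_mpoly_idfun mevalD mevalZ => -> ->; rewrite mulr0 addr0.
rewrite val_aff_gen // meval_grid_aff; have [i [j [lj xj]]] := xT w wT.
by apply: (grid_prod_eq0 lj); rewrite xj.
Qed.

Lemma proj_zero (L : projpt m F) (v : 'rV[F]_m.+1) : v != 0 -> (v <= val L)%MS ->
  (forall w, w \in T -> grid_zero w (v 0 ord0) (fun i => v 0 (lift ord0 i))) ->
  Vset idfun proj_span L.
Proof.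
move=> v0 vL vT; apply: (@span_ind _ _ (fun p : dhomog m.+1 F d =>
  proj_root (map_mpoly idfun (val p)) L)) => [|c u u'|_ /mapP[w wT ->]].
- by move=> v' _; rewrite !raddf0.
- move=> ru ru' v' v'L; move: (ru v' v'L) (ru' v' v'L).
  by rewrite linearP /= !map_mpoly_idfun mevalD mevalZ => -> ->; rewrite mulr0 addr0.
move=> v' v'L; have [c ->] := projpt_scale v0 vL v'L.
rewrite val_proj_gen // meval_grid_proj; have [i [j [lj xj]]] := vT w wT.
by apply: (grid_prod_eq0 lj); rewrite !mxE xj mulrCA.
Qed.

Lemma felt_footprint (b : {ffun 'I_m -> 'I_q}) w :
  b \in footprint n k d q r -> w \in T -> grid_zero w 1 (fun i => felt (b i)).
Proof.
move=> bf wT; have [i bi] := footprintP bf wT.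
by exists i, (b i); rewrite mulr1.
Qed.

Lemma felt_ffun_inj (b b' : {ffun 'I_m -> 'I_q}) :
  (forall i, felt (b i) = felt (b' i)) -> b = b'.
Proof. by move=> E; apply/ffunP => i; apply/val_inj/(felt_inj _ _ (E i)). Qed.

Lemma f_A_le_Z_card : (f_A d m k q r <= Z_card aff_span)%N.
Proof.
apply: leq_trans (f_A_le_footprint n0 dq rC) _.
pose pt (b : {ffun 'I_m -> 'I_q}) : 'rV[F]_m := \row_i felt (b i).
have pt_inj : injective pt.
  by move=> b b' /rowP E; apply: felt_ffun_inj => i; have := E i; rewrite !mxE.
rewrite -(card_imset _ pt_inj); apply/subset_leq_card/fintype.subsetP => _ /imsetP[b bf ->].
rewrite inE; apply/asboolP/aff_zero => w /(felt_footprint bf)[i [j [lj bj]]].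
by exists i, j; rewrite mxE.
Qed.

Definition point0 : projpt m F.
Proof.
exists <<delta_mx 0 0 : 'rV[F]_m.+1>>%MS; rewrite genmx_id eqxx mxrank_gen.
by rewrite mxrank_delta.
Defined.

Definition point (v : 'rV[F]_m.+1) : projpt m F := insubd point0 <<v>>%MS.

Lemma val_point v : v != 0 -> val (point v) = <<v>>%MS.
Proof. by move=> v0; rewrite val_insubd genmx_id eqxx mxrank_gen rank_rV v0. Qed.

Lemma sub_point v : v != 0 -> (v <= val (point v))%MS.
Proof. by move=> v0; rewrite val_point // genmxE. Qed.

Lemma point_eq v v' : v != 0 -> v' != 0 -> point v = point v' -> exists c, v' = c *: v.
Proof.
by move=> v0 v0' E; apply: (projpt_scale v0 (sub_point v0)); rewrite E sub_point.
Qed.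

Definition finite_points : {set projpt m F} :=
  [set point (homvec 1 (fun i => felt (b i))) | b : {ffun 'I_m -> 'I_q} in footprint n k d q r].

Lemma homvec_neq0 t y : t != 0 -> homvec t y != 0.
Proof. by apply: contra_neq => E; rewrite -(homvec0 t y) E mxE. Qed.

Lemma card_finite_points : #|finite_points| = #|footprint n k d q r|.
Proof.
apply: card_imset => b b' /point_eq[]; try exact/homvec_neq0/oner_neq0.
move=> c E; have c1 : c = 1.
  by have := congr1 (fun v : 'rV_ _ => v 0 ord0) E; rewrite !mxE unlift_none mulr1.
apply: felt_ffun_inj => i.
have := congr1 (fun v : 'rV_ _ => v 0 (lift ord0 i)) E.
by rewrite c1 scale1r !homvec_lift.
Qed.

Section Infinity.
Variable M : nat.

Definition tails : {set {ffun 'I_m -> F}} :=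
  [set f in family (fun j : 'I_m => if (j < M)%N then pred1 0 else predT) | f != 0].

Definition infinite_points : {set projpt m F} :=
  [set point (homvec 0 f) | f : {ffun 'I_m -> F} in tails].

Lemma card_tails : #|tails| = (q ^ (m - M) - 1)%N.
Proof.
have -> : (q ^ (m - M))%N =
    #|family (fun j : 'I_m => if (j < M)%N then pred1 (0 : F) else predT)|.
  rewrite card_family_prod -prod_nat_const_nat big_geq_mkord big_mkcond /=.
  by apply: eq_bigr => j _; case: ltnP => _; rewrite ?card1.
rewrite [X in (X - 1)%N](cardD1 (0 : {ffun 'I_m -> F})) (_ : 0 \in _ = true) ?addKn; last first.
  by apply/familyP => j; rewrite ffunE; case: ifP; rewrite ?inE.
by rewrite cardsE; apply: eq_card => f; rewrite !inE andbC.
Qed.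

Lemma homvec_tail_neq0 f : f \in tails -> homvec 0 f != 0.
Proof.
rewrite inE => /andP[_]; apply: contra_neq => E; apply/ffunP => i.
by rewrite ffunE -(homvec_lift 0 f i) E mxE.
Qed.

(** Vectors spanning the same line differ by a nonzero scalar, so each fibre of [point] has at most
    q - 1 elements. *)
Lemma card_infinite_points : ((q ^ (m - M) - 1) %/ (q - 1) <= #|infinite_points|)%N.
Proof.
have q1 : (0 < q - 1)%N by rewrite subn_gt0 finalg.card_finNzRing_gt1.
rewrite -[X in (_ <= X)%N](mulnK _ q1); apply: leq_div2r.
rewrite -card_tails -sum1_card.
rewrite (partition_big_imset (fun f : {ffun 'I_m -> F} => point (homvec 0 f))) /=.
rewrite -sum_nat_const; apply: leq_sum => _ /imsetP[f fT ->].
rewrite sum1_card.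
pose sc (c : F) : {ffun 'I_m -> F} := [ffun i => c * f i].
have cE : (#|[set sc c | c in predC1 (0%R : F)]| <= q - 1)%N.
  by apply: leq_trans (leq_imset_card _ _) _; rewrite cardC1 subn1.
apply: leq_trans _ cE.
apply/subset_leq_card/fintype.subsetP => f'; rewrite unfold_in => /andP[f'T /eqP E].
have [c cE] := point_eq (homvec_tail_neq0 fT) (homvec_tail_neq0 f'T) (esym E).
have f'E : f' = sc c.
  apply/ffunP => i; have := congr1 (fun v : 'rV_ _ => v 0 (lift ord0 i)) cE.
  by rewrite ffunE homvec_lift mxE homvec_lift.
apply/imsetP; exists c => //; rewrite inE.
move: f'T; rewrite inE => /andP[_]; apply: contra_neq => c0.
by apply/ffunP => i; rewrite f'E c0 !ffunE mul0r.
Qed.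

End Infinity.

Lemma f_P_le_V_card : (f_P d m k q r <= V_card proj_span)%N.
Proof.
rewrite f_PE //; set M := maxn _ n.
have fin := f_A_le_footprint n0 dq rC; rewrite -card_finite_points in fin.
apply: leq_trans (leq_add fin (card_infinite_points M)) _.
have disj : [disjoint finite_points & infinite_points M].
  rewrite finset.disjoints_subset; apply/fintype.subsetP => _ /imsetP[b _ ->].
  rewrite inE; apply/negP => /imsetP[f fT] /esym E.
  have [||c] := point_eq _ _ E; first exact: homvec_tail_neq0 fT.
    exact/homvec_neq0/oner_neq0.
  move/(congr1 (fun v : 'rV_ _ => v 0 ord0))/eqP.
  by rewrite homvec0 mxE homvec0 mulr0 oner_eq0.
have := (leq_card_setU finite_points (infinite_points M)).2; rewrite disj => /eqP <-.
apply/subset_leq_card/fintype.subsetP => L; rewrite !inE => /orP[] /imsetP[].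
  move=> b bf ->.
  have v0 := homvec_neq0 (fun i => felt (b i)) (oner_neq0 F).
  apply: (proj_zero v0 (sub_point v0)) => w wT.
  have [i [j [lj E]]] := felt_footprint bf wT.
  by exists i, j; rewrite homvec0 homvec_lift.
move=> f fT ->; have v0 := homvec_tail_neq0 fT.
have := fT; rewrite inE => /andP[/familyP fam fn0].
have fM (i : 'I_m) : (i < M)%N -> f i = 0 by move=> iM; have := fam i; rewrite iM => /eqP.
(* For l = m + 1 there are no [tails], so alpha is nonzero here. *)
have lm : (lead_index d m k q r <= m)%N.
  rewrite leqNgt; apply: contra_neqN fn0 => ml; apply/ffunP => i; rewrite ffunE.
  by apply: fM; rewrite leq_max (leq_trans _ ml) // ltnS ltnW.
apply: (proj_zero v0 (sub_point v0)) => w wT.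
have [i iM wi] := exponents_lead d0 dq rC lm wT.
(* With t = 0 every factor y_i - a_j t is y_i, so j = 0 will do. *)
by exists i, 0%N; rewrite homvec0 homvec_lift fM // mulr0.
Qed.

End Construction.

(** * Comparison with the maxima *)

Lemma Z_card_le_e_A (F : finFieldType) d m k r (W : {vspace degle m F d}) :
  \dim W = r -> dim_le (@zariski_closed_affine m (Fbar F)) (Zset (to_Fbar F) W) k ->
  (Z_card W <= e_A F d m k r)%N.
Proof.
move=> dW dimW; have lt : (Z_card W < #|{: 'rV[F]_m}|.+1)%N by rewrite ltnS max_card.
apply: (bigop.bigmax_sup (Ordinal lt)) => //.
by apply/asboolP; exists W.
Qed.

Lemma V_card_le_e_P (F : finFieldType) d m k r (W : {vspace dhomog m.+1 F d}) :
  \dim W = r -> dim_le (@zariski_closed_proj m (Fbar F)) (Vset (to_Fbar F) W) k ->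
  (V_card W <= e_P F d m k r)%N.
Proof.
move=> dW dimW; have lt : (V_card W < #|{: projpt m F}|.+1)%N by rewrite ltnS max_card.
apply: (bigop.bigmax_sup (Ordinal lt)) => //.
by apply/asboolP; exists W.
Qed.

Close Scope ring_scope.

Theorem proposition1p6 (F : finFieldType) (m d r k : nat) :
  0 < m -> 0 < d -> 0 < r ->
  k <= m - 1 ->
  m - k <= r -> r <= 'C(m + d, d) ->
  d + 1 <= #|F| ->
  f_A d m k #|F| r <= e_A F d m k r /\
  f_P d m k #|F| r <= e_P F d m k r.
Proof.
move=> m0 d0 _ km; have mE : m = (m - k) + k by lia.
have : 0 < m - k by lia.
move: (m - k) mE => n mE n0 nr; rewrite {}mE in m0 km * => rC; rewrite addn1 => dq.
split.
  apply: leq_trans (f_A_le_Z_card n0 dq rC) _.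
  by apply: Z_card_le_e_A; [exact: dim_aff_span | exact: aff_span_dim_le].
apply: leq_trans (f_P_le_V_card n0 d0 dq nr rC) _.
by apply: V_card_le_e_P; [exact: dim_proj_span | exact: proj_span_dim_le].
Qed.
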